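(* Let $\nu>2$ be fixed, let $G$ be a chordal graph (information filtering network) on $\{1,\dots,p\}$ with clique-forest structure given by cliques $\mathcal C$ and separators $\mathcal S$, and let $\hat{\mathbf x}(s)\in\mathbb R^p$, $s=1,\dots,q$, be observations. Consider the multivariate Student-t log-likelihood $$\ell(\boldsymbol\mu,\mathbf J,\nu)=q\log\!\left(\frac{\Gamma(\frac{\nu+p}{2})}{(\nu-2)^{p/2}\pi^{p/2}\Gamma(\frac\nu2)}\right)+\frac q2\log|\mathbf J|-\frac{\nu+p}{2}\sum_{s=1}^q\log\!\left(1+\frac{1}{\nu-2}d^2_{\hat{\mathbf x}(s)}\right),$$ $d^2_{\hat{\mathbf x}(s)}=(\hat{\mathbf x}(s)-\boldsymbol\mu)^\top\mathbf J(\hat{\mathbf x}(s)-\boldsymbol\mu)$, over $\boldsymbol\mu\in\mathbb R^p$ and symmetric positive definite $\mathbf J$ whose off-diagonal entries may be non-zero only at edges of $G$. Let $(\boldsymbol\mu^*,\mathbf J^* )$ be the maximum likelihood solution, let $d^{*2}_{\hat{\mathbf x}(s)}=(\hat{\mathbf x}(s)-\boldsymbol\mu^* )^\top\mathbf J^*(\hat{\mathbf x}(s)-\boldsymbol\mu^* )$ and $w_s^*=\dfrac{\nu+p}{\nu+\frac{\nu}{\nu-2}d^{*2}_{\hat{\mathbf x}(s)}}$. Then $$J^*_{i,j}=\sum_{c\in\mathcal C}\big(\boldsymbol\Sigma_c^{*-1}\big)_{i,j}-\sum_{s\in\mathcal S}\big(\boldsymbol\Sigma_s^{*-1}\big)_{i,j}$$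 when $i,j$ are an edge of a clique (or $i=j$), and $J^*_{i,j}=0$ for all other pairs, where $\boldsymbol\Sigma^*_c,\boldsymbol\Sigma^*_s$ are the restrictions to the variables in $c$, respectively $s$, of the weighted covariance matrix $$\boldsymbol\Sigma^*_{i,j}=\frac{\nu}{\nu-2}\,\frac1q\sum_{s=1}^q w_s^*\,(\hat x_i(s)-\mu_i^* )(\hat x_j(s)-\mu_j^* ).$$
   Context: A clique forest (junction tree) of a chordal graph has as nodes the cliques $c\in\mathcal C$ and as links the separators $s\in\mathcal S$, each separator being the intersection of two adjacent cliques. For a subset $a$ of variables, $(\boldsymbol\Sigma_a^{*-1})_{i,j}$ denotes the entry of the inverse of the $|a|\times|a|$ matrix $\boldsymbol\Sigma^*_a$ for variables $i,j\in a$, and $0$ if $i\notin a$ or $j\notin a$. $\mathbf J$ is the inverse covariance of the Student-t distribution with $\nu>2$ degrees of freedom. *)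

(* Defs.v *)
From HB Require Import structures.
From mathcomp Require Import all_boot all_order all_algebra.
From mathcomp Require Import all_classical all_reals all_analysis.
Set Implicit Arguments. Unset Strict Implicit. Unset Printing Implicit Defensive.
Import Order.TTheory GRing.Theory Num.Theory.
Local Open Scope ring_scope.

Section Defs.
Variable R : realType.

Definition Gamma (x : R) : R :=
  fine (\int[@lebesgue_measure R]_(t in `]0%R, +oo[%classic)
          ((t `^ (x - 1)) * expR (- t))%:E)%E.

Variable p : nat.

Definition simple_graph (e : rel 'I_p) := symmetric e /\ irreflexive e.

Definition chordal (e : rel 'I_p) : Prop :=
  forall s : seq 'I_p, uniq s -> (4 <= size s)%N -> cycle e s ->
    exists x y, [/\ x \in s, y \in s, x != y & e x y] /\
                (y != next s x) /\ (x != next s y).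

Definition is_clique (e : rel 'I_p) (A : {set 'I_p}) : Prop :=
  forall x y, x \in A -> y \in A -> x != y -> e x y.

Definition maximal_clique (e : rel 'I_p) (A : {set 'I_p}) : Prop :=
  is_clique e A /\ forall B, is_clique e B -> A \subset B -> B = A.

(* ---------- clique forest (junction tree) ----------
   nodes: 'I_m, node c carrying the clique K c; links: the list F of pairs. *)
Definition frel m (F : seq ('I_m * 'I_m)) : rel 'I_m :=
  fun a b => ((a, b) \in F) || ((b, a) \in F).

Definition is_forest m (F : seq ('I_m * 'I_m)) : Prop :=
  (forall a b, (a, b) \in F -> a != b) /\
  uniq [seq [set f.1; f.2] | f <- F] /\
  (* acyclic: every link is a bridge *)
  (forall f, f \in F ->
     ~~ connect (frel (rem f F)) f.1 f.2).

Definition clique_forest (e : rel 'I_p) m (K : 'I_m -> {set 'I_p})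
  (F : seq ('I_m * 'I_m)) : Prop :=
  [/\ injective K,
      (forall A, maximal_clique e A <-> exists c, A = K c),
      is_forest F &
      (forall v a b, v \in K a -> v \in K b ->
         connect [rel x y | frel F x y && (v \in K x) && (v \in K y)] a b)].

Definition separator m (K : 'I_m -> {set 'I_p}) (f : 'I_m * 'I_m) :=
  K f.1 :&: K f.2.

Definition sym_posdef (J : 'M[R]_p) : Prop :=
  J^T = J /\ forall v : 'rV[R]_p, v != 0 -> 0 < (v *m J *m v^T) 0 0.

Definition admissible (e : rel 'I_p) (J : 'M[R]_p) : Prop :=
  sym_posdef J /\ forall i j, i != j -> ~~ e i j -> J i j = 0.

Definition restr (a : {set 'I_p}) (S : 'M[R]_p) : 'M[R]_#|a| :=
  mxsub (@enum_val _ (mem a)) (@enum_val _ (mem a)) S.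

Definition pos_in (a : {set 'I_p}) (i : 'I_p) : option 'I_#|a| :=
  [pick k : 'I_#|a| | enum_val k == i].

Definition padinv (a : {set 'I_p}) (S : 'M[R]_p) : 'M[R]_p :=
  \matrix_(i, j) match pos_in a i, pos_in a j with
                 | Some k, Some l => invmx (restr a S) k l
                 | _, _ => 0
                 end.

Variable q : nat.

Definition d2 (x mu : 'rV[R]_p) (J : 'M[R]_p) : R :=
  ((x - mu) *m J *m (x - mu)^T) 0 0.

Definition loglik (nu : R) (x : 'I_q -> 'rV[R]_p) (mu : 'rV[R]_p)
  (J : 'M[R]_p) : R :=
  q%:R * ln (Gamma ((nu + p%:R) / 2) /
             ((nu - 2) `^ (p%:R / 2) * pi `^ (p%:R / 2) * Gamma (nu / 2)))
  + q%:R / 2 * ln (\det J)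
  - (nu + p%:R) / 2 * \sum_(s < q) ln (1 + (nu - 2)^-1 * d2 (x s) mu J).

Definition weight (nu : R) (x : 'I_q -> 'rV[R]_p) (mu : 'rV[R]_p)
  (J : 'M[R]_p) (s : 'I_q) : R :=
  (nu + p%:R) / (nu + nu / (nu - 2) * d2 (x s) mu J).

Definition wcov (nu : R) (x : 'I_q -> 'rV[R]_p) (mu : 'rV[R]_p)
  (J : 'M[R]_p) : 'M[R]_p :=
  \matrix_(i, j) (nu / (nu - 2) * q%:R^-1 *
     \sum_(s < q) weight nu x mu J s * (x s 0 i - mu 0 i) * (x s 0 j - mu 0 j)).

End Defs.

(* Main.v *)
(** With S the inverse of J*, the likelihood along the rank-one shifts
    J* + t u^T u, for u = e_i or u = e_i + e_j with ij an edge, gives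
    ln(1 + t u S u^T) <= t u Sigma* u^T for every t with 1 + t u S u^T > 0;
    hence u S u^T = u Sigma* u^T, so S and Sigma* have the same entries on
    every clique.  It remains to see that a positive definite matrix J* with
    the sparsity pattern of G is the alternating sum of the padded inverses of
    the clique and separator blocks of S.  If the padded inverse of the
    block A :|: B of S has no entry between A :\: B and B :\: A, it is the
    inverse for A, plus that for B, minus that for A :&: B; cutting the forest
    at a link f gives two covers which meet exactly in the separator of f, and
    the sparsity pattern is inherited by both halves. *)
Require Import Defs.
From HB Require Import structures.
From mathcomp Require Import all_boot all_order all_algebra.
From mathcomp Require Import all_classical all_reals all_analysis.
From mathcomp Require Import ring lra.
From mathcomp Require polyrcf.
Import Order.TTheory GRing.Theory Num.Theory.
Local Open Scope ring_scope.

(** * Padded inverses of the principal blocks of a positive definite matrix *)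

Section PaddedInverse.
Set Implicit Arguments.
Unset Strict Implicit.
Variables (R : realType) (p : nat).
Implicit Types (A B : {set 'I_p}) (S : 'M[R]_p).

(** Multiplication by this matrix restricts to the coordinates in A, and by its transpose pads with
    zeros; blocks and padded inverses thus become plain matrix products. *)
Definition selmx A : 'M[R]_(#|A|, p) := rowsub (@enum_val _ (mem A)) 1%:M.

Definition setproj A : 'M[R]_p := diag_mx (\row_i (i \in A)%:R).

Lemma setprojE A i j : setproj A i j = ((i == j) && (i \in A))%:R.
Proof. by rewrite !mxE; case: (_ == _); case: (_ \in A). Qed.

Lemma setproj_mulE A n (M : 'M[R]_(p, n)) i j :
  (setproj A *m M) i j = (i \in A)%:R * M i j.
Proof. by rewrite mul_diag_mx !mxE. Qed.

Lemma mul_setprojE A n (M : 'M[R]_(n, p)) i j :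
  (M *m setproj A) i j = M i j * (j \in A)%:R.
Proof. by rewrite mul_mx_diag !mxE. Qed.

Lemma setproj_mul A B : setproj A *m setproj B = setproj (A :&: B).
Proof.
apply/matrixP => i j; rewrite setproj_mulE !setprojE inE.
by case: (_ == _); case: (i \in A); case: (i \in B); rewrite ?mulr1 ?mulr0 ?mul0r.
Qed.

Lemma setproj0 : setproj finset.set0 = 0.
Proof. by apply/matrixP => i j; rewrite setprojE inE andbF mxE. Qed.

Lemma setprojT : setproj [set: 'I_p]%SET = 1%:M.
Proof. by apply/matrixP => i j; rewrite setprojE inE andbT !mxE. Qed.

Lemma setprojU A B :
  setproj (A :|: B) = setproj A + setproj B - setproj (A :&: B).
Proof.
apply/matrixP => i j; rewrite setprojE mxE mxE setprojE setprojE mxE setprojE !inE.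
by case: (_ == _); case: (i \in A); case: (i \in B); rewrite /=; ring.
Qed.

Lemma tr_setproj A : (setproj A)^T = setproj A.
Proof. exact: tr_diag_mx. Qed.

Lemma selmx_tr A : selmx A *m (selmx A)^T = 1%:M.
Proof.
apply/matrixP => i j; rewrite mxE (bigD1 (enum_val i)) //= big1 ?addr0.
  by rewrite !mxE eqxx mul1r (inj_eq enum_val_inj) eq_sym.
by move=> k ki; rewrite !mxE eq_sym (negPf ki) mul0r.
Qed.

Lemma tr_selmx A : (selmx A)^T *m selmx A = setproj A.
Proof.
apply/matrixP => i j; rewrite setprojE mxE.
case: (boolP (i \in A)) => iA; last first.
  rewrite andbF big1 // => k _; rewrite !mxE.
  case: eqP => [ki|]; last by rewrite mul0r.
  by move: iA; rewrite -ki enum_valP.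
have lE : enum_val (enum_rank_in iA i) = i by rewrite enum_rankK_in.
move: (enum_rank_in _ _) lE => l lE; rewrite (bigD1 l) //= !mxE lE eqxx mul1r andbT.
rewrite big1 ?addr0 // => k kl; rewrite !mxE -{1}lE (inj_eq enum_val_inj).
by rewrite (negPf kl) mul0r.
Qed.

Lemma restrE A S : restr A S = selmx A *m S *m (selmx A)^T.
Proof.
rewrite /selmx -rowsubE trmx_mxsub trmx1 mulmx_colsub mulmx1.
by apply/matrixP => i j; rewrite !mxE.
Qed.

Lemma selmxE A k i : selmx A k i = (pos_in A i == Some k)%:R.
Proof.
rewrite !mxE /pos_in; case: pickP => [l /eqP li | no] /=; last by rewrite no.
by rewrite -li (inj_eq enum_val_inj) eq_sym.
Qed.

Lemma padinvE A S :
  padinv A S = (selmx A)^T *m invmx (restr A S) *m selmx A.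
Proof.
have delta0 (k l : 'I_#|A|) : l != k -> (Some k == Some l)%:R = 0 :> R.
  by move=> lk; rewrite (inj_eq Some_inj) eq_sym (negPf lk).
apply/matrixP => i j; rewrite mxE [RHS]mxE.
under eq_bigr do rewrite mxE selmxE.
case: (pos_in A j) => [l|]; last first.
  by rewrite [RHS]big1 => [|l _]; rewrite ?mulr0 //; case: (pos_in A i).
rewrite (bigD1 l) //= eqxx mulr1 [X in _ + X]big1 ?addr0; last first.
  by move=> l' ll'; rewrite delta0 // mulr0.
under eq_bigr do rewrite mxE selmxE.
case: (pos_in A i) => [k|]; last by rewrite big1 // => k _; rewrite mul0r.
rewrite (bigD1 k) //= eqxx mul1r big1 ?addr0 // => k' kk'.
by rewrite delta0 // mul0r.
Qed.

Lemma eq_padinv A S S' :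
  (forall i j, i \in A -> j \in A -> S i j = S' i j) ->
  padinv A S = padinv A S'.
Proof.
move=> eqS; suff restr_eq : restr A S = restr A S' by rewrite !padinvE restr_eq.
by apply/matrixP => i j; rewrite !mxE eqS ?enum_valP.
Qed.

Lemma padinv_set0 S : padinv finset.set0 S = 0.
Proof.
apply/matrixP => i j; rewrite !mxE /pos_in; case: pickP => // k _.
by have := enum_valP k; rewrite inE.
Qed.

Lemma setproj_padinv A S : setproj A *m padinv A S = padinv A S.
Proof. by rewrite padinvE -tr_selmx !mulmxA -[_ *m _ *m _^T]mulmxA selmx_tr mulmx1. Qed.

Lemma padinv_setproj A S : padinv A S *m setproj A = padinv A S.
Proof. by rewrite padinvE -tr_selmx -!mulmxA [selmx A *m _]mulmxA selmx_tr mul1mx. Qed.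

Lemma padinv_supp A S i j : padinv A S i j != 0 -> (i \in A) && (j \in A).
Proof.
rewrite -setproj_padinv -padinv_setproj setproj_mulE mul_setprojE.
by case: (i \in A); case: (j \in A); rewrite ?mulr0 ?mul0r ?mulr0 ?eqxx.
Qed.

Section PosDef.
Variable S : 'M[R]_p.
Hypothesis Spd : sym_posdef S.

Lemma posdef_eq0 n (V : 'M[R]_(n, p)) : V *m S *m V^T = 0 -> V = 0.
Proof.
move=> V0; apply/row_matrixP => i; rewrite row0; apply/eqP/negPn/negP => Vi.
have := Spd.2 _ Vi; suff -> : row i V *m S *m (row i V)^T = 0 by rewrite mxE ltxx.
by rewrite tr_row colE mulmxA -!row_mul V0 mul0mx row0.
Qed.

(** A vector in the kernel of the block, padded by zeros, has zero form under S, hence is zero. *)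
Lemma restr_unit A : restr A S \in unitmx.
Proof.
rewrite -row_free_unit -kermx_eq0; apply/eqP.
have k0 := mulmx_ker (restr A S).
have : kermx (restr A S) *m selmx A = 0.
  apply: posdef_eq0; rewrite trmx_mul.
  by rewrite !mulmxA -[_ *m _ *m S]mulmxA -[_ *m (_ *m S) *m _]mulmxA -restrE k0 mul0mx.
by move/(congr1 (mulmxr (selmx A)^T)); rewrite /= -mulmxA selmx_tr mulmx1 mul0mx.
Qed.

Lemma padinv_mul A : padinv A S *m S *m setproj A = setproj A.
Proof.
rewrite padinvE -tr_selmx -!mulmxA; congr (_ *m _).
by rewrite [S *m _]mulmxA [selmx A *m _]mulmxA [selmx A *m _]mulmxA -restrE
  mulmxA mulVmx ?mul1mx // restr_unit.
Qed.

Lemma tr_padinv A : (padinv A S)^T = padinv A S.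
Proof.
rewrite padinvE !trmx_mul trmxK trmx_inv mulmxA restrE !trmx_mul trmxK.
by rewrite Spd.1 !mulmxA.
Qed.

Lemma mul_padinv A : setproj A *m S *m padinv A S = setproj A.
Proof.
apply: trmx_inj; rewrite trmx_mul tr_padinv trmx_mul Spd.1 tr_setproj.
by rewrite mulmxA padinv_mul.
Qed.

(** Uniqueness of inverses on the coordinates in A: a left inverse there equals the right inverse
    given by [mul_padinv]. This is how the alternating sums are recognised as padded inverses. *)
Lemma padinv_unique A (M : 'M[R]_p) :
  M *m setproj A = M -> M *m S *m setproj A = setproj A -> M = padinv A S.
Proof.
move=> MA MS; rewrite -setproj_padinv -MS -!mulmxA setproj_padinv.
by rewrite -[in RHS]MA -mulmxA [setproj A *m _]mulmxA mul_padinv.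
Qed.

Section Union.
Variables A B : {set 'I_p}.
Hypothesis AB0 : forall i j, i \in A :\: B -> j \in B :\: A ->
  padinv (A :|: B) S i j = 0.

Let X := A :\: B.
Let Y := B :\: A.
Let Z := A :&: B.
Let C := A :|: B.
Let M := padinv C S.

(* Conditional independence of A and B given A :&: B: the residual W of the
   regression of A on A :&: B vanishes on B. *)
Lemma padinv_regression :
  padinv B S *m S *m setproj A = padinv Z S *m S *m setproj A.
Proof.
(* The columns of U are the regression coefficients on Z of the variables in A; they are supported
   in Z. *)
set U := padinv Z S *m S *m setproj A.
have subU (D : {set _}) : Z \subset D -> setproj D *m U = U.
  move=> /finset.setIidPr DZ; rewrite /U !mulmxA -[in LHS](setproj_padinv Z) mulmxA.
  by rewrite setproj_mul DZ setproj_padinv.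
have MSC (D : {set _}) (V : 'M[R]_p) : D \subset C -> setproj D *m V = V -> M *m S *m V = V.
  move=> /finset.setIidPr DC DV; rewrite -DV -DC -setproj_mul.
  by rewrite !mulmxA padinv_mul.
have [ZA ZB AC] : [/\ Z \subset A, Z \subset B & A \subset C].
  by rewrite finset.subsetIl finset.subsetIr finset.subsetUl.
(* W holds the covariances of all variables with the residuals of that regression. *)
pose W := S *m (setproj A - U).
have ZW : setproj Z *m W = 0.
  by rewrite /W /U mulmxBr mulmxBr !mulmxA mul_padinv subrr.
have MW : M *m W = setproj A - U.
  by rewrite /W mulmxA mulmxBr !(MSC A) ?subU // setproj_mul finset.setIid.
have MC : M *m setproj C = M by exact: padinv_setproj.
have CM : setproj C *m M = M by exact: setproj_padinv.
have CE : setproj C = setproj X + (setproj Y + setproj Z).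
  apply/matrixP => i j; rewrite !mxE !inE.
  by case: (i == j); case: (i \in A); case: (i \in B); rewrite /= ?mulr0n ?mul0rn ?addr0 ?add0r.
have BE : setproj B = setproj Y + setproj Z.
  apply/matrixP => i j; rewrite !mxE !inE.
  by case: (i == j); case: (i \in A); case: (i \in B); rewrite /= ?mulr0n ?mul0rn ?addr0 ?add0r.
have YMX : setproj Y *m M *m setproj X = 0.
  apply/matrixP => i j; rewrite mul_setprojE setproj_mulE [RHS]mxE.
  case: (boolP (j \in X)) => jX; last by rewrite mulr0.
  case: (boolP (i \in Y)) => iY; last by rewrite mul0r mul0r.
  by rewrite /M -tr_padinv mxE AB0 // mulr0 mul0r.
set T := setproj Y *m W.
have YMT : setproj Y *m M *m T = 0.
  have : setproj Y *m M *m W = 0.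
    rewrite -mulmxA MW mulmxBr setproj_mul -(subU Z) // mulmxA setproj_mul.
    suff [-> ->] : Y :&: A = finset.set0 /\ Y :&: Z = finset.set0.
      by rewrite setproj0 mul0mx subrr.
    by split; apply/finset.setP => i; rewrite !inE; case: (i \in A);
      rewrite /= ?andbF.
  (* The columns of M are split over X, Y and Z: the X part dies by [YMX], the Z part because W
     vanishes on Z, and T is what remains. *)
  rewrite -{1}MC CE mulmxA mulmxDr mulmxDl YMX mul0mx add0r.
  by rewrite -mulmxA mulmxDl ZW addr0.
have YT : setproj Y *m T = T by rewrite /T mulmxA setproj_mul finset.setIid.
(* Since M S M = M, the S-form of M T is T^T M T. This is zero because T lives on Y, where M T
   vanishes. *)
have MT0 : M *m T = 0.
  apply: (can_inj trmxK); rewrite trmx0; apply: posdef_eq0.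
  have MSM : M *m S *m M = M by rewrite -{2}CM mulmxA padinv_mul CM.
  rewrite trmxK trmx_mul tr_padinv -/M -!mulmxA (mulmxA M) (mulmxA _ M) MSM.
  by rewrite -YT trmx_mul tr_setproj -!mulmxA [setproj Y *m (M *m _)]mulmxA YT YMT mulmx0.
have T0 : T = 0.
  have /finset.setIidPr CY : Y \subset C.
    by apply: fintype.subset_trans (finset.subsetUr _ _); apply: finset.subsetDl.
  rewrite -YT -CY -setproj_mul -mulmxA YT -(mul_padinv C) -/M.
  by rewrite -!mulmxA MT0 !mulmx0.
have BW : setproj B *m W = 0 by rewrite BE mulmxDl ZW addr0.
have : padinv B S *m W = 0 by rewrite -padinv_setproj -mulmxA BW mulmx0.
rewrite /W !mulmxBr mulmxA => /subr0_eq ->.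
by rewrite -(subU B ZB) !mulmxA padinv_mul.
Qed.

End Union.

(** Let N be the right-hand side. By the regression identity the terms for B and A :&: B cancel in N
    S on the columns in A, so N S is the identity there; by symmetry it is the identity on B too,
    and [padinv_unique] applies. *)
Lemma padinv_setU A B :
  (forall i j, i \in A :\: B -> j \in B :\: A -> padinv (A :|: B) S i j = 0) ->
  padinv (A :|: B) S = padinv A S + padinv B S - padinv (A :&: B) S.
Proof.
move=> AB0; have regA := padinv_regression AB0.
have regB : padinv A S *m S *m setproj B = padinv (A :&: B) S *m S *m setproj B.
  rewrite finset.setIC; apply: padinv_regression => i j iB jA.
  by rewrite finset.setUC -tr_padinv mxE AB0.
have suppU (D : {set 'I_p}) : D \subset A :|: B -> padinv D S *m setproj (A :|: B) = padinv D S.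
  by move=> /finset.setIidPr DU; rewrite -[in LHS]padinv_setproj -mulmxA setproj_mul
    finset.setIC DU padinv_setproj.
apply/esym/padinv_unique.
  rewrite mulmxBl mulmxDl !suppU ?finset.subsetUl ?finset.subsetUr //.
  exact: fintype.subset_trans (finset.subsetIl _ _) (finset.subsetUl _ _).
set N := _ - _.
have NA : N *m S *m setproj A = setproj A.
  by rewrite /N !mulmxBl !mulmxDl padinv_mul regA addrK.
have NB : N *m S *m setproj B = setproj B.
  by rewrite /N !mulmxBl !mulmxDl padinv_mul regB [_ + setproj B]addrC addrK.
by rewrite setprojU -setproj_mul mulmxBr mulmxDr mulmxA NA NB.
Qed.

End PosDef.

Lemma posdef_unit (J : 'M[R]_p) : sym_posdef J -> J \in unitmx.
Proof.
move=> Jpd; rewrite -row_free_unit -kermx_eq0; apply/eqP/(posdef_eq0 Jpd).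
by rewrite mulmx_ker mul0mx.
Qed.

Lemma posdef_inv (J : 'M[R]_p) : sym_posdef J -> sym_posdef (invmx J).
Proof.
move=> Jpd; have Ju := posdef_unit Jpd; split=> [|v v0]; first by rewrite trmx_inv Jpd.1.
have w0 : v *m invmx J != 0.
  by apply: contra_neq v0 => vJ; rewrite -(mulmxKV Ju v) vJ mul0mx.
by have := Jpd.2 _ w0; rewrite trmx_mul trmx_inv Jpd.1 !mulmxA mulmxKV.
Qed.

Lemma padinv_setT (J : 'M[R]_p) : sym_posdef J -> padinv [set: 'I_p]%SET (invmx J) = J.
Proof.
move=> Jpd; apply/esym/(padinv_unique (posdef_inv Jpd)); rewrite setprojT !mulmx1 //.
by rewrite mulmxV // posdef_unit.
Qed.

End PaddedInverse.

(** * Alternating clique and separator sums, by cutting the forest *)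

Section CliqueForest.
Set Implicit Arguments.
Unset Strict Implicit.

(** An edge may be sent to a path, even an empty one, so that maps collapsing part of the graph are
    covered. *)
Lemma connect_homo (T T' : finType) (r : rel T) (r' : rel T') (h : T -> T') x y :
  (forall x y, r x y -> connect r' (h x) (h y)) ->
  connect r x y -> connect r' (h x) (h y).
Proof.
move=> hr /connectP[s rs ->] {y}; elim: s x rs => [|z s IHs] x /=; first by [].
by move=> /andP[/hr xz /IHs]; apply: connect_trans.
Qed.

Lemma connect_crossing (T : finType) (r : rel T) (A : {set T}) x y :
  connect r x y -> x \in A -> y \notin A ->
  exists u w, [/\ r u w, u \in A & w \notin A].
Proof.
move=> /connectP[s rs ->] {y}; elim: s x rs => [|z s IHs] x /=; first by move=> _ ->.
move=> /andP[xz zs] xA lastA; case: (boolP (z \in A)) => zA; first exact: IHs zA lastA.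
by exists x, z.
Qed.

Variables (R : realType) (p : nat) (S : 'M[R]_p) (Spd : sym_posdef S).
Variables (m : nat) (K : 'I_m -> {set 'I_p}) (F : seq ('I_m * 'I_m)).
Hypothesis forestF : is_forest F.
Implicit Types (T : {set 'I_m}).

Definition cover_of T := (\bigcup_(c in T) K c)%SET.

Definition link_in T v : rel 'I_m :=
  [rel x y | [&& Defs.frel F x y, x \in T, y \in T, v \in K x & v \in K y]].

Definition running_intersection T := forall v a b, a \in T -> b \in T ->
  v \in K a -> v \in K b -> connect (link_in T v) a b.

(** The sparsity pattern of G, phrased through the cliques of T so that it can be passed on to parts
    of the forest. *)
Definition clique_supported T := forall i j,
  padinv (cover_of T) S i j != 0 -> exists2 c, c \in T & (i \in K c) && (j \in K c).

Definition clique_formula T := padinv (cover_of T) S =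
  \sum_(c in T) padinv (K c) S
  - \sum_(f <- F | (f.1 \in T) && (f.2 \in T)) padinv (separator K f) S.

Lemma frel_sym : symmetric (Defs.frel F).
Proof. by move=> x y; rewrite /Defs.frel orbC. Qed.

(* Every path of T retracts onto T' by sending T :\: T' to c0. *)
Lemma running_intersection_sub T T' c0 : T' \subset T ->
  (forall x y, Defs.frel F x y -> x \in T' -> y \in T -> y \notin T' -> x = c0) ->
  running_intersection T -> running_intersection T'.
Proof.
move=> /fintype.subsetP sT cross RI v a b aT bT va vb.
pose h x := if x \in T' then x else c0.
have -> : a = h a by rewrite /h aT.
have -> : b = h b by rewrite /h bT.
apply: connect_homo (RI v a b _ _ va vb); [|exact: sT|exact: sT].
move=> x y /and5P[xy xT yT vx vy]; rewrite /h.
case: ifPn => xT'; case: ifPn => yT' //.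
- by apply/connect1/and5P.
- by rewrite (cross x y).
- by rewrite (cross y x) // frel_sym.
Qed.

Lemma cover_ofP T v : reflect (exists2 c, c \in T & v \in K c) (v \in cover_of T).
Proof. exact: finset.bigcupP. Qed.

Lemma clique_supportedU T1 T2 : clique_supported (T1 :|: T2) ->
  padinv (cover_of (T1 :|: T2)) S = padinv (cover_of T1) S
    + padinv (cover_of T2) S - padinv (cover_of T1 :&: cover_of T2) S.
Proof.
move=> supp; have coverU : cover_of (T1 :|: T2) = cover_of T1 :|: cover_of T2.
  exact: finset.bigcup_setU.
rewrite coverU; apply: padinv_setU => // i j; rewrite !inE => /andP[iN iA] /andP[jN jB].
apply/eqP/negPn/negP; rewrite -coverU => /supp[c]; rewrite inE => cT /andP[ic jc].
case/orP: cT => cT.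
- by move/cover_ofP: jN; apply; exists c.
- by move/cover_ofP: iN; apply; exists c.
Qed.

(** For a pair inside both covers the second hypothesis provides the clique. For any other pair the
    terms of [cover_of T2] and of the intersection vanish, so the entry is that of the union, and
    its clique cannot come from T2. *)
Lemma clique_supportedUl T1 T2 : clique_supported (T1 :|: T2) ->
  (forall i j, i \in cover_of T1 :&: cover_of T2 ->
     j \in cover_of T1 :&: cover_of T2 ->
     exists2 c, c \in T1 & (i \in K c) && (j \in K c)) ->
  clique_supported T1.
Proof.
move=> supp sep i j ij0; have /andP[iA jA] := padinv_supp ij0.
case: (boolP ((i \in cover_of T2) && (j \in cover_of T2))) => [/andP[iB jB]|nB].
  by apply: sep; rewrite inE ?iA ?jA.
have out (D : {set 'I_p}) : D \subset cover_of T2 -> padinv D S i j = 0.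
  move=> /fintype.subsetP DB; apply/eqP/negPn/negP => /padinv_supp/andP[iD jD].
  by rewrite !DB in nB.
have : padinv (cover_of (T1 :|: T2)) S i j != 0.
  rewrite (clique_supportedU supp) mxE [X in X + _ != 0]mxE [X in _ + X]mxE.
  rewrite (out (cover_of T2)) // addr0.
  by rewrite (out (_ :&: _)) ?finset.subsetIr // subr0.
move=> /supp[c]; rewrite inE => /orP[cT1 ijc|cT2 /andP[ic jc]]; first by exists c.
by case/negP: nB; apply/andP; split; apply/cover_ofP; exists c.
Qed.

(** The equation between the link sums is left as a hypothesis so that one gluing lemma serves both
    a cut link, where the covers meet in a separator, and an isolated node, where they are
    disjoint. *)
Lemma clique_formulaU T1 T2 : [disjoint T1 & T2] ->
  clique_supported (T1 :|: T2) ->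
  \sum_(f <- F | (f.1 \in T1 :|: T2) && (f.2 \in T1 :|: T2)) padinv (separator K f) S
  = \sum_(f <- F | (f.1 \in T1) && (f.2 \in T1)) padinv (separator K f) S
    + \sum_(f <- F | (f.1 \in T2) && (f.2 \in T2)) padinv (separator K f) S
    + padinv (cover_of T1 :&: cover_of T2) S ->
  clique_formula T1 -> clique_formula T2 -> clique_formula (T1 :|: T2).
Proof.
move=> dT supp linksE f1 f2; rewrite /clique_formula clique_supportedU // linksE.
rewrite f1 f2 [in RHS](eq_bigl [in [predU T1 & T2]]) => [|c]; last by rewrite !inE.
rewrite bigU //=.
by rewrite !opprD !addrA; congr (_ - _ - _); rewrite addrAC.
Qed.

Lemma cover_of_crossing T T1 T2 v : T = T1 :|: T2 -> [disjoint T1 & T2] ->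
  running_intersection T -> v \in cover_of T1 :&: cover_of T2 ->
  exists x y, [/\ Defs.frel F x y, x \in T1, y \in T2, v \in K x & v \in K y].
Proof.
move=> TE dT RI; rewrite inE => /andP[/cover_ofP[a aT va] /cover_ofP[b bT vb]].
have ab : connect (link_in T v) a b by apply: RI; rewrite ?TE ?inE ?aT ?bT ?orbT.
have bT1 : b \notin T1 by rewrite (disjointFl dT).
have [x [y [/and5P[xy _ yT vx vy] xT1 yT1]]] := connect_crossing ab aT bT1.
by exists x, y; split=> //; move: yT; rewrite TE inE (negPf yT1).
Qed.

(** Every crossing link joins c1 to c2. Hence each side is a retract of T, and all variables shared
    by the two covers lie in both K c1 and K c2, a single clique on either side. *)
Lemma forest_split_invariants T T1 T2 (c1 c2 : 'I_m) : T = T1 :|: T2 ->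
  [disjoint T1 & T2] -> c1 \in T1 ->
  (forall x y, Defs.frel F x y -> x \in T1 -> y \in T2 -> x = c1 /\ y = c2) ->
  running_intersection T -> clique_supported T ->
  [/\ running_intersection T1, running_intersection T2,
      clique_supported T1 & clique_supported T2].
Proof.
move=> TE dT c1T cross RI supp.
have sT1 : T1 \subset T by rewrite TE finset.subsetUl.
have sT2 : T2 \subset T by rewrite TE finset.subsetUr.
have inT2 y : y \in T -> y \notin T1 -> y \in T2.
  by rewrite TE inE => /orP[->|].
have inT1 y : y \in T -> y \notin T2 -> y \in T1.
  by rewrite TE inE => /orP[|->].
split.
- apply: (running_intersection_sub sT1 (c0 := c1)) RI => x y xy xT yT yT1.
  by have [] := cross x y xy xT (inT2 _ yT yT1).
- apply: (running_intersection_sub sT2 (c0 := c2)) RI => x y xy xT yT yT2.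
  by rewrite frel_sym in xy; have [] := cross y x xy (inT1 _ yT yT2) xT.
- apply: (@clique_supportedUl T1 T2); first by rewrite -TE.
  move=> i j /(cover_of_crossing TE dT RI)[x [y [xy xT yT ix iy]]].
  move=> /(cover_of_crossing TE dT RI)[x' [y' [xy' xT' yT' jx jy]]].
  exists x => //; have [xE _] := cross _ _ xy xT yT.
  by have [x'E _] := cross _ _ xy' xT' yT'; rewrite ix xE -x'E jx.
- apply: (@clique_supportedUl T2 T1); first by rewrite finset.setUC -TE.
  rewrite finset.setIC.
  move=> i j /(cover_of_crossing TE dT RI)[x [y [xy xT yT ix iy]]].
  move=> /(cover_of_crossing TE dT RI)[x' [y' [xy' xT' yT' jx jy]]].
  exists y => //; have [_ yE] := cross _ _ xy xT yT.
  by have [_ y'E] := cross _ _ xy' xT' yT'; rewrite iy yE -y'E jy.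
Qed.

Lemma clique_formulaP T :
  running_intersection T -> clique_supported T -> clique_formula T.
Proof.
have [n] := ubnP #|T|; elim: n T => // n IHn T; rewrite ltnS => leTn RI supp.
have IH (T' : {set 'I_m}) (c : 'I_m) : T' \subset T -> c \in T -> c \notin T' ->
    running_intersection T' -> clique_supported T' -> clique_formula T'.
  move=> sT' cT cT'; apply: IHn; apply: leq_trans leTn; apply: proper_card.
  by apply/properP; split=> //; exists c.
(* Strong induction on the number of nodes: cut T at a link if it has one, otherwise split off a
   single node. *)
case: (boolP (has (fun f => (f.1 \in T) && (f.2 \in T)) F)) => [/hasP[f fF /andP[aT bT]]|nolink].
  pose r := [rel x y | [&& Defs.frel (rem f F) x y, x \in T & y \in T]].
  (* T1 is the component of f.1 in T once f is removed; f.2 falls outside it because every link of a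
     forest is a bridge. *)
  pose T1 := [set c in T | connect r f.1 c]%SET.
  pose T2 := T :\: T1.
  have sT1 : T1 \subset T by apply/fintype.subsetP => c; rewrite inE => /andP[].
  have TE : T = T1 :|: T2 by rewrite -[LHS](finset.setID T T1) (finset.setIidPr sT1).
  have dT : [disjoint T1 & T2] by rewrite finset.disjoints_subset finset.setCD finset.subsetUr.
  have aT1 : f.1 \in T1 by rewrite inE aT connect0.
  have bT1 : f.2 \notin T1.
    rewrite inE bT /=; apply: contraNN (forestF.2.2 _ fF).
    by apply: (connect_homo (h := id)) => x y /and3P[xy _ _]; apply: connect1.
  have bT2 : f.2 \in T2 by rewrite inE bT1.
  have linked g : g \in rem f F -> g.1 \in T -> g.2 \in T -> (g.1 \in T1) = (g.2 \in T1).
    case: g => x y gF xT yT /=; rewrite !inE xT yT /=.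
    by apply/idP/idP => /connect_trans; apply; apply: connect1;
      rewrite /= /Defs.frel gF xT yT ?orbT.
  have in_rem g : g \in F -> g != f -> g \in rem f F.
    by rewrite (perm_mem (perm_to_rem fF)) inE => /orP[->|].
  have cross x y : Defs.frel F x y -> x \in T1 -> y \in T2 -> x = f.1 /\ y = f.2.
    move=> xy xT1; rewrite inE => /andP[yT1 yT].
    have xT := fintype.subsetP sT1 _ xT1.
    case/orP: xy => [xyF|yxF].
      have [<- //|ne] := eqVneq (x, y) f.
      by have /= := linked _ (in_rem _ xyF ne) xT yT; rewrite xT1 (negPf yT1).
    have [fE|ne] := eqVneq (y, x) f.
      by move: bT1; rewrite -fE xT1.
    by have /= := linked _ (in_rem _ yxF ne) yT xT; rewrite xT1 (negPf yT1).
  have [RI1 RI2 supp1 supp2] := forest_split_invariants TE dT aT1 cross RI supp.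
  rewrite TE; apply: clique_formulaU => //; rewrite -?TE //; last 2 first.
  - exact: (IH _ f.2).
  - by apply: (IH _ f.1) => //; rewrite ?finset.subsetDl // inE aT1.
  have -> : cover_of T1 :&: cover_of T2 = separator K f.
    apply/finset.setP => v; apply/idP/idP.
      move=> /(cover_of_crossing TE dT RI)[x [y [xy xT yT vx vy]]].
      by have [xE yE] := cross _ _ xy xT yT; rewrite inE -xE -yE vx vy.
    rewrite inE => /andP[va vb]; rewrite inE.
    by apply/andP; split; apply/cover_ofP; [exists f.1|exists f.2].
  (* The term of f occurs only in the sum over T. Each remaining link has both ends on the same
     side, so its first end decides to which sum it belongs. *)
  rewrite !(perm_big _ (perm_to_rem fF)) /= !big_cons aT bT aT1 (negPf bT1) /=.
  rewrite [f.1 \in T2]inE aT1 /= addrC; congr (_ + _).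
  rewrite (bigID (fun g => g.1 \in T1)) /=.
  congr (_ + _); rewrite big_seq_cond [RHS]big_seq_cond; apply: eq_bigl => g.
  - case: (boolP (g \in rem f F)) => //= /linked gE.
    apply/idP/idP => [/andP[/andP[g1 g2] g1T]|/andP[g1 g2]].
      by rewrite g1T -gE.
    by rewrite g1 !(fintype.subsetP sT1).
  - case: (boolP (g \in rem f F)) => //= /linked gE; rewrite !finset.in_setD.
    case: (boolP (g.1 \in T)) => g1; rewrite ?andbF //=.
    case: (boolP (g.2 \in T)) => g2; rewrite ?andbF //=.
    by rewrite gE // !andbT andbb.
have nolinks T' : T' \subset T ->
    \sum_(f <- F | (f.1 \in T') && (f.2 \in T')) padinv (separator K f) S = 0.
  move=> /fintype.subsetP sT'; apply: big1_seq => f /andP[/andP[f1 f2] fF].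
  by case/negP: nolink; apply/hasP; exists f; rewrite // !sT'.
have [-> | [c cT]] := finset.set_0Vmem T.
  rewrite /clique_formula nolinks ?finset.sub0set // big_set0 subr0.
  by rewrite /cover_of big_set0 padinv_set0.
pose T2 := T :\ c.
have TE : T = [set c]%SET :|: T2 by rewrite finset.setD1K.
have dT : [disjoint [set c]%SET & T2] by rewrite disjoints1 !inE eqxx.
have nofrel x y : x \in T -> y \in T -> ~~ Defs.frel F x y.
  move=> xT yT; apply: contraNN nolink => /orP[] xy; apply/hasP.
    by exists (x, y); rewrite // xT yT.
  by exists (y, x); rewrite // xT yT.
have sc : [set c]%SET \subset T by rewrite finset.sub1set.
have s2 : T2 \subset T by rewrite finset.subsetDl.
(* No link crosses, so the condition holds vacuously and c can stand for both ends. *)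
have cross x y : Defs.frel F x y -> x \in [set c]%SET -> y \in T2 -> x = c /\ y = c.
  move=> xy /(fintype.subsetP sc) xT /(fintype.subsetP s2) yT.
  by have := nofrel _ _ xT yT; rewrite xy.
have [_ RI2 _ supp2] := forest_split_invariants TE dT (finset.set11 c) cross RI supp.
rewrite TE; apply: clique_formulaU => //; rewrite -?TE //.
- have -> : cover_of [set c]%SET :&: cover_of T2 = finset.set0.
    apply/finset.setP => v; rewrite [RHS]inE; apply/negP.
    move=> /(cover_of_crossing TE dT RI)[x [y [xy xT yT _ _]]].
    by have := nofrel _ _ (fintype.subsetP sc _ xT) (fintype.subsetP s2 _ yT); rewrite xy.
  by rewrite !nolinks // padinv_set0 !addr0.
- by rewrite /clique_formula nolinks // big_set1 subr0 /cover_of big_set1.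
- by apply: (IH _ c) => //; rewrite !inE eqxx.
Qed.

End CliqueForest.

(** * Determinant and positivity under rank-one shifts, and tangency to the logarithm *)

Section RankOnePerturbation.
Set Implicit Arguments.
Unset Strict Implicit.
Variables (R : realType) (p : nat).
Implicit Types (J S : 'M[R]_p) (u v : 'rV[R]_p).

(** The matrix determinant lemma: unipotent block factors turn a block triangular matrix with
    diagonal blocks 1 + a b and 1 into one with diagonal blocks 1 and 1 + b a. *)
Lemma det_one_add_rank1 (a : 'cV[R]_p) (b : 'rV[R]_p) :
  \det (1%:M + a *m b) = 1 + (b *m a) 0 0.
Proof.
pose L := block_mx (1%:M : 'M[R]_p) 0 b (1%:M : 'M[R]_1).
pose L' := block_mx (1%:M : 'M[R]_p) 0 (- b) (1%:M : 'M[R]_1).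
have LML : L *m block_mx (1%:M + a *m b) a 0 1%:M *m L'
    = block_mx 1%:M a 0 (1%:M + b *m a).
  rewrite /L /L' !mulmx_block !(mulmx0, mul0mx, mulmx1, mul1mx, addr0, add0r).
  rewrite !mulmxN addrK; congr (block_mx _ _ _ _); last by rewrite addrC.
  by rewrite mulmxDl mul1mx mulmxDr mulmx1 opprD mulmxA addrA addrK subrr.
have /(congr1 determinant) := LML.
rewrite !det_mulmx /L /L' !det_lblock !det_ublock !det1 !mul1r !mulr1 => ->.
by rewrite det_mx11 !mxE.
Qed.

Definition rank1_shift J (t : R) u : 'M[R]_p := J + t *: (u^T *m u).

Lemma det_rank1_shift J t u : J \in unitmx ->
  \det (rank1_shift J t u) = \det J * (1 + t * (u *m invmx J *m u^T) 0 0).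
Proof.
move=> Ju; have -> : rank1_shift J t u = J *m (1%:M + (t *: (invmx J *m u^T)) *m u).
  by rewrite mulmxDr mulmx1 -scalemxAl -scalemxAr !mulmxA mulmxV // mul1mx.
by rewrite det_mulmx det_one_add_rank1 -scalemxAr mxE mulmxA.
Qed.

Lemma rank1_shift_form J t u v :
  (v *m rank1_shift J t u *m v^T) 0 0
  = (v *m J *m v^T) 0 0 + t * ((v *m u^T) 0 0) ^+ 2.
Proof.
rewrite /rank1_shift mulmxDr mulmxDl mxE -scalemxAr -scalemxAl [X in _ + X]mxE.
congr (_ + _ * _).
have -> : v *m (u^T *m u) *m v^T = (v *m u^T) *m (u *m v^T) by rewrite !mulmxA.
rewrite [in LHS]mxE big_ord1 expr2; congr (_ * _).
by rewrite -[u *m v^T]trmxK trmx_mul trmxK mxE.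
Qed.

Lemma posdef_ge0 J v : sym_posdef J -> 0 <= (v *m J *m v^T) 0 0.
Proof.
by move=> Jpd; have [->|/Jpd.2/ltW//] := eqVneq v 0; rewrite !mul0mx mxE.
Qed.

Lemma posdef_CauchySchwarz J u v : sym_posdef J ->
  ((v *m u^T) 0 0) ^+ 2
    <= (v *m J *m v^T) 0 0 * (u *m invmx J *m u^T) 0 0.
Proof.
move=> Jpd; have Ju := posdef_unit Jpd.
have [->|u0] := eqVneq u 0; first by rewrite trmx0 !mulmx0 mxE expr0n mulr0.
have s0 := (posdef_inv Jpd).2 _ u0.
set s := (u *m _ *m _) 0 0 in s0 *; set a := (v *m u^T) 0 0.
(* This l minimises the J-form of v - l w; its nonnegativity there is the claim. *)
pose w := u *m invmx J; pose l := a / s.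
have wJ : w *m J = u by rewrite mulmxKV.
have Jw : J *m w^T = u^T by rewrite -{1}Jpd.1 -trmx_mul wJ.
have := posdef_ge0 (v - l *: w) Jpd.
have -> : (v - l *: w) *m J *m (v - l *: w)^T
    = v *m J *m v^T - l *: (v *m u^T) - l *: (v *m u^T)^T + (l * l) *: (u *m invmx J *m u^T).
  have -> : (v - l *: w)^T = v^T - l *: w^T by rewrite linearB linearZ.
  rewrite !mulmxBl !mulmxBr -!scalemxAl -!scalemxAr wJ.
  rewrite -(mulmxA v J w^T) Jw (trmx_mul v) trmxK scalerA opprD opprK addrA.
  rewrite -/w; congr (_ + _ *: _); by rewrite -Jw mulmxA wJ.
have entry (A B C : 'M[R]_1) : (A - l *: B - l *: B^T + (l * l) *: C) 0 0
    = A 0 0 - l * B 0 0 - l * B 0 0 + l * l * C 0 0 by rewrite !mxE.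
rewrite entry -/a -/s.
have -> : (v *m J *m v^T) 0 0 - l * a - l * a + l * l * s
    = (v *m J *m v^T) 0 0 - a ^+ 2 / s.
  by rewrite /l; field; rewrite gt_eqF.
by rewrite subr_ge0 ler_pdivrMr.
Qed.

Lemma posdef_rank1_shift J t u : sym_posdef J ->
  0 < 1 + t * (u *m invmx J *m u^T) 0 0 -> sym_posdef (rank1_shift J t u).
Proof.
move=> Jpd ts; split=> [|v v0].
  by rewrite /rank1_shift linearD /= linearZ /= trmx_mul trmxK Jpd.1.
rewrite rank1_shift_form; have vJ := Jpd.2 _ v0.
have ab := posdef_CauchySchwarz u v Jpd.
move: (u *m _ *m _) ((v *m J *m _) 0 0) ((v *m u^T) 0 0) ts vJ ab => s b a ts b0 ab.
have [t0|t0] := leP 0 t; first by rewrite ltr_wpDr // mulr_ge0 ?sqr_ge0.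
(* For negative t, Cauchy-Schwarz bounds the loss t a^2 below by t b s. *)
apply: lt_le_trans (_ : b * (1 + t * s 0 0) <= _); first exact: mulr_gt0.
rewrite mulrDr mulr1 lerD2l mulrCA; exact: ler_wnM2l (ltW t0) _ _ ab.
Qed.

(** A nonnegative root of the characteristic polynomial of -J would be an eigenvalue contradicting
    positivity. The polynomial is monic with value det J at 0, so det J <= 0 would force such a root
    by the intermediate value theorem. *)
Lemma det_posdef_gt0 J : sym_posdef J -> 0 < \det J.
Proof.
move=> Jpd; have detE : (char_poly (- J)).[0] = \det J.
  rewrite horner_coef0 char_poly_det -[- J]scaleN1r detZ mulrA -exprMn mulrNN mulr1.
  by rewrite expr1n mul1r.
have noroot a : 0 <= a -> ~~ root (char_poly (- J)) a.
  move=> a0; rewrite -eigenvalue_root_char; apply/negP => /eigenvalueP[v vJ v0].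
  have := Jpd.2 _ v0; rewrite -[J]opprK mulmxN vJ mulNmx -scalemxAl mxE mxE.
  rewrite oppr_gt0 ltNge mulr_ge0 // mxE sumr_ge0 // => i _.
  by rewrite mxE -expr2 sqr_ge0.
rewrite ltNge; apply/negP => det0.
have [|n pn] := @polyrcf.poly_pinfty_gt_lc _ (char_poly (- J)).
  by rewrite (monicP (char_poly_monic _)).
have pn0 : 0 <= (char_poly (- J)).[Num.max 0 n].
  by apply: le_trans (pn _ _); rewrite ?(monicP (char_poly_monic _)) ?le_max ?lexx ?orbT.
have [||a /andP[a0 _] ra] := @poly_ivt _ (char_poly (- J)) 0 (Num.max 0 n).
- by rewrite le_max lexx.
- by rewrite detE det0.
- by move: (noroot _ a0); rewrite ra.
Qed.

Lemma ln_le_line1 (k : R) : (forall y, 0 < y -> ln y <= (y - 1) * k) -> k = 1.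
Proof.
(* The lower bound (y - 1) / y <= ln y is ln (1 + z) <= z at z = 1/y - 1. *)
move=> lnk; have key y : 0 < y -> (y - 1) / y <= (y - 1) * k.
  move=> y0; apply: le_trans (lnk _ y0); rewrite -[y in ln y]invrK lnV ?posrE ?invr_gt0 //.
  have := @le_ln1Dx R (y^-1 - 1).
  have -> : 1 + (y^-1 - 1) = y^-1 by rewrite addrC subrK.
  have -> : (y - 1) / y = 1 - y^-1 by rewrite mulrBl divff ?gt_eqF // mul1r.
  have y1 : 0 < y^-1 by rewrite invr_gt0.
  by move=> /(_ ltac:(lra)); lra.
have key' y : 0 < y -> y - 1 <= (y - 1) * (k * y).
  by move=> y0; have := key y y0; rewrite ler_pdivrMr // mulrA.
have k0 : 1 / 2 <= k by have := key' 2 ltac:(lra); lra.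
(* If k differs from 1, the midpoint of 1 and 1/k makes (y - 1) (k y - 1) negative, against
   [key']. *)
apply/eqP; rewrite eq_le; apply/andP; split; rewrite leNgt; apply/negP => k1.
  have ki : k * k^-1 = 1 by rewrite divff // gt_eqF //; lra.
  have := key' ((1 + k^-1) / 2); have : 0 < k^-1 by rewrite invr_gt0; lra.
  nra.
have ki : k * k^-1 = 1 by rewrite divff // gt_eqF //; lra.
have := key' ((1 + k^-1) / 2); have : 0 < k^-1 by rewrite invr_gt0; lra.
nra.
Qed.

End RankOnePerturbation.

(** * First-order conditions at the maximum of the likelihood *)

Section Stationarity.
Set Implicit Arguments.
Unset Strict Implicit.
Variables (R : realType) (p q : nat) (nu : R) (e : rel 'I_p).
Variables (x : 'I_q -> 'rV[R]_p) (mu : 'rV[R]_p) (J : 'M[R]_p).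
Hypotheses (hnu : 2 < nu) (hq : (0 < q)%N) (hJ : admissible e J).
Hypothesis hmax : forall J', admissible e J' ->
  loglik nu x mu J' <= loglik nu x mu J.

Lemma wcov_form (u : 'rV[R]_p) :
  (u *m wcov nu x mu J *m u^T) 0 0 =
  nu / (nu - 2) * q%:R^-1 *
    \sum_(s < q) weight nu x mu J s * (((x s - mu) *m u^T) 0 0) ^+ 2.
Proof.
have -> : wcov nu x mu J = (nu / (nu - 2) * q%:R^-1) *:
    \sum_(s < q) weight nu x mu J s *: ((x s - mu)^T *m (x s - mu)).
  apply/matrixP => i j; rewrite !mxE summxE; congr (_ * _).
  by apply: eq_bigr => s _; rewrite !mxE big_ord1 !mxE mulrA.
rewrite -scalemxAr -scalemxAl mxE mulmx_sumr mulmx_suml summxE; congr (_ * _).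
apply: eq_bigr => s _; rewrite -scalemxAr -scalemxAl mxE; congr (_ * _).
have -> : u *m ((x s - mu)^T *m (x s - mu)) *m u^T =
    ((x s - mu) *m u^T)^T *m ((x s - mu) *m u^T).
  by rewrite trmx_mul trmxK !mulmxA.
by rewrite mxE big_ord1 mxE expr2.
Qed.

(* Concavity of the logarithm bounds the loss in the quadratic terms linearly
   in the shift, so the maximum forces [ln y <= (y - 1) * k] for all [y > 0],
   where [y] is the factor by which the shift multiplies the determinant. *)
Lemma stationarity_form (u : 'rV[R]_p) :
  (forall i j, i != j -> ~~ e i j -> u 0 i * u 0 j = 0) ->
  (u *m invmx J *m u^T) 0 0 = (u *m wcov nu x mu J *m u^T) 0 0.
Proof.
move=> patu; have [->|u0] := eqVneq u 0; first by rewrite !mul0mx.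
have [Jpd Jpat] := hJ; have Ju := posdef_unit Jpd.
have detJ := det_posdef_gt0 Jpd.
have s0 := (posdef_inv Jpd).2 _ u0.
set sg := (u *m invmx J *m _) 0 0 in s0 *; set tau := (u *m wcov _ _ _ _ *m _) 0 0.
suff k1 : tau / sg = 1 by rewrite -[RHS](divfK (lt0r_neq0 s0)) k1 mul1r.
(* The shift t is chosen so that the determinant is multiplied by exactly y. *)
apply: ln_le_line1 => y y0; set t := (y - 1) / sg.
have yE : 1 + t * sg = y by rewrite /t divfK ?gt_eqF // addrC subrK.
have J'pd : sym_posdef (rank1_shift J t u) by apply: posdef_rank1_shift; rewrite // yE.
have J'adm : admissible e (rank1_shift J t u).
  by split=> // i j ij eij; rewrite !mxE big_ord1 !mxE Jpat // patu // mulr0 addr0.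
have := hmax J'adm; rewrite /loglik det_rank1_shift // -/sg yE.
rewrite (@lnM _ (\det J) y) ?posrE // => le_max.
rewrite mulrA.
have c0 : 0 < (nu - 2)^-1 by rewrite invr_gt0 subr_gt0.
have n0 : 0 < nu by exact: lt_trans hnu.
have q0 : 0 < q%:R :> R by rewrite ltr0n.
have np : 0 < (nu + p%:R) / 2 by rewrite divr_gt0 // ltr_pwDl.
set c := (nu - 2)^-1 in c0 le_max.
pose a s := ((x s - mu) *m u^T) 0 0.
have d0 s : 0 < 1 + c * d2 (x s) mu J.
  by have := mulr_ge0 (ltW c0) (posdef_ge0 (x s - mu) Jpd); rewrite -/(d2 _ _ _); lra.
have d0' s : 0 < 1 + c * d2 (x s) mu (rank1_shift J t u).
  by have := mulr_ge0 (ltW c0) (posdef_ge0 (x s - mu) J'pd); rewrite -/(d2 _ _ _); lra.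
have bound s : ln (1 + c * d2 (x s) mu (rank1_shift J t u))
    - ln (1 + c * d2 (x s) mu J) <= c * t * a s ^+ 2 / (1 + c * d2 (x s) mu J).
  rewrite -ln_div ?posrE //.
  set z := _ / _; set r := _ / _.
  have rE : r = 1 + z.
    rewrite /r /z; have -> : d2 (x s) mu (rank1_shift J t u)
      = d2 (x s) mu J + t * a s ^+ 2 by exact: rank1_shift_form.
    move: (d0 s); clearbody c t; move: (d2 _ _ _) (a s) => d b d0s.
    by field; rewrite gt_eqF.
  by rewrite rE le_ln1Dx // -subr_gt0 opprK addrC -rE divr_gt0.
have : q%:R / 2 * ln y <= (nu + p%:R) / 2
    * \sum_(s < q) (c * t * a s ^+ 2 / (1 + c * d2 (x s) mu J)).
  apply: le_trans (_ : (nu + p%:R) / 2 * \sum_(s < q)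
    (ln (1 + c * d2 (x s) mu (rank1_shift J t u)) - ln (1 + c * d2 (x s) mu J)) <= _).
    rewrite sumrB; move: le_max; rewrite -/(d2 _ _ _); move: (ln (Gamma _ / _)) => A.
    lra.
  by rewrite ler_pM2l //; apply: ler_sum => s _.
(* The weights appear here: nu / (nu - 2) times [weight] is (nu + p) c / (1 + c d), with c = 1 / (nu
   - 2) and d the squared distance. *)
have -> : (nu + p%:R) / 2 * \sum_(s < q) (c * t * a s ^+ 2 / (1 + c * d2 (x s) mu J))
    = q%:R / 2 * (t * tau).
  rewrite /tau wcov_form !mulr_sumr; apply: eq_bigr => s _; rewrite -/(a s) /weight.
  have := d0 s; rewrite /c; move: (d2 _ _ _) (a s) => d b d0s.
  have n2 : 0 < nu - 2 by rewrite subr_gt0.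
  have n2d : 0 < nu - 2 + d.
    have -> : nu - 2 + d = (nu - 2) * (1 + (nu - 2)^-1 * d) by field; rewrite gt_eqF.
    exact: mulr_gt0.
  by field; rewrite -mulrDr mulf_neq0 !gt_eqF.
rewrite ler_pM2l ?divr_gt0 // /t => /le_trans; apply.
by rewrite mulrAC.
Qed.

(** Polarisation: the forms at e_i and e_j give the diagonal entries, and the form at e_i + e_j then
    gives the entry at the edge ij, both matrices being symmetric. *)
Lemma stationarity i j : (i == j) || e i j -> symmetric e ->
  invmx J i j = wcov nu x mu J i j.
Proof.
move=> ij syme.
have entry (S : 'M[R]_p) k l : (('e_k : 'rV[R]_p) *m S *m ('e_l : 'rV[R]_p)^T) 0 0 = S k l.
  by rewrite -rowE trmx_delta -colE !mxE.
have diag k : invmx J k k = wcov nu x mu J k k.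
  have := @stationarity_form 'e_k; rewrite !entry; apply=> k1 k2 k12 _.
  rewrite !mxE !eqxx /=; case: eqP => [<-|]; last by rewrite mul0r.
  by rewrite eq_sym (negPf k12) mulr0.
have [<- //|nij] := eqVneq i j; rewrite (negPf nij) /= in ij.
have := @stationarity_form ('e_i + 'e_j).
rewrite linearD /= !mulmxDl !mulmxDr.
have add2 (A B C D : 'M[R]_1) : (A + B + (C + D)) 0 0 = A 0 0 + B 0 0 + (C 0 0 + D 0 0).
  by rewrite !mxE.
rewrite !add2 !entry !diag.
have symi : invmx J j i = invmx J i j.
  by rewrite -[in LHS]hJ.1.1 -trmx_inv mxE.
have symw : wcov nu x mu J j i = wcov nu x mu J i j.
  by rewrite !mxE; congr (_ * _); apply: eq_bigr => s _; rewrite mulrAC.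
rewrite symi symw => h.
suff /h : forall k l : 'I_p, k != l -> ~~ e k l ->
  ('e_i + 'e_j : 'rV[R]_p) 0 k * ('e_i + 'e_j : 'rV[R]_p) 0 l = 0 by lra.
move=> k l kl ekl; rewrite !mxE !eqxx /=.
have [ki|ki] := eqVneq k i; have [kj|kj] := eqVneq k j;
  have [li|li] := eqVneq l i; have [lj|lj] := eqVneq l j;
  rewrite ?addr0 ?mulr0 ?mul0r //;
  by move: kl ekl; rewrite ?ki ?kj ?li ?lj ?eqxx // ?(syme j i) ij.
Qed.

End Stationarity.

(** * Assembly: from the inverse of J to the weighted covariance *)

Lemma clique_sub_maximal (p : nat) (e : rel 'I_p) (A : {set 'I_p}) :
  is_clique e A -> exists2 B, maximal_clique e B & A \subset B.
Proof.
move=> Ac; have := @finset.maxset_exists _ (fun B : {set 'I_p} => `[< is_clique e B >]) A.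
move=> /(_ (asboolT Ac))[B /finset.maxsetP[/asboolP Bc Bmax] AB].
by exists B => //; split=> // D /asboolT Dc BD; apply: Bmax.
Qed.

Theorem theorem4 (R : realType) (p q : nat) (nu : R) (hnu : 2 < nu)
  (e : rel 'I_p) (he : simple_graph e) (hch : chordal e)
  (m : nat) (K : 'I_m -> {set 'I_p}) (F : seq ('I_m * 'I_m))
  (hCF : clique_forest e K F)
  (hq : (0 < q)%N) (x : 'I_q -> 'rV[R]_p)
  (mu : 'rV[R]_p) (J : 'M[R]_p) (hJ : admissible e J)
  (hmax : forall (mu' : 'rV[R]_p) (J' : 'M[R]_p), admissible e J' ->
            loglik nu x mu' J' <= loglik nu x mu J) :
  forall i j : 'I_p,
    J i j = if (i == j) || e i j then
              \sum_(c < m) padinv (K c) (wcov nu x mu J) i j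
              - \sum_(f <- F) padinv (separator K f) (wcov nu x mu J) i j
            else 0.
Proof.
have [syme irre] := he; have [injK maxK forestF RI] := hCF; have [Jpd Jpat] := hJ.
have cliqueK c : is_clique e (K c).
  by have [] := (maxK (K c)).2 (ex_intro _ c erefl).
have in_clique i j : (i == j) || e i j -> exists c, (i \in K c) && (j \in K c).
  move=> ij; have : is_clique e [set i; j]%SET.
    move=> k l; rewrite !inE => /orP[/eqP->|/eqP->] /orP[/eqP->|/eqP->];
      rewrite ?eqxx // => kl; first by move: ij; rewrite (negPf kl).
    by rewrite syme; move: ij; rewrite eq_sym (negPf kl).
  move=> /clique_sub_maximal[_ /maxK[c ->] /fintype.subsetP ijc].
  by exists c; rewrite !ijc // !inE eqxx ?orbT.
have edge_clique c i j : i \in K c -> j \in K c -> (i == j) || e i j.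
  by move=> ic jc; have [//|ij] := eqVneq i j; exact: (cliqueK c).
have coverT : cover_of K [set: 'I_m]%SET = [set: 'I_p]%SET.
  apply/finset.setP => i; rewrite [RHS]inE; apply/cover_ofP.
  by have [|c /andP[ic _]] := in_clique i i; rewrite ?eqxx //; exists c; rewrite ?inE.
(* A padded inverse sees only the entries on its own block, and within a clique these agree for the
   two matrices. *)
have restrS (D : {set 'I_p}) c : D \subset K c ->
    padinv D (wcov nu x mu J) = padinv D (invmx J).
  move=> /fintype.subsetP DK; apply: eq_padinv => i j iD jD.
  by rewrite (stationarity hnu hq hJ (hmax mu)) ?(edge_clique c) ?DK.
have := @clique_formulaP R p (invmx J) (posdef_inv Jpd) m K F forestF [set: 'I_m]%SET.
rewrite /clique_formula coverT padinv_setT // => formula i j.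
case: ifPn => [_|/norP[ij eij]]; last exact: Jpat.
rewrite {1}formula.
- rewrite mxE summxE [X in _ + X]mxE summxE.
  congr (_ - _).
    by apply: eq_big => [c|c _]; rewrite ?inE // (restrS _ c).
  apply: eq_big => [f|f _]; rewrite ?inE // (restrS _ f.1) //.
  exact: finset.subsetIl.
- move=> v a b _ _ va vb; have := RI v a b va vb.
  apply: (connect_homo (h := id)) => y z /andP[/andP[yz vy] vz].
  by apply/connect1/and5P; split; rewrite ?inE.
(* The padded inverse over all variables is J itself, so its nonzero entries sit on the diagonal or
   at edges, each inside a maximal clique. *)
- move=> k l; rewrite coverT padinv_setT // => kl0.
  have [|c kl] := in_clique k l; last by exists c; rewrite ?inE.
  by apply: contraNT kl0 => /norP[kl ekl]; rewrite Jpat.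
Qed.
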